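(* Let $\overline{A_0A_1A_2A_3}$ be a tetrahedron in $\mathbb{A}^3$ with $B$-quadrances $Q_{ij}$ ($0\le i<j\le 3$), $B$-quadreas $\mathcal{A}_{012},\mathcal{A}_{013},\mathcal{A}_{023},\mathcal{A}_{123}$, $B$-quadrume $\mathcal{V}$ and $B$-dihedral spreads $E_{ij}$ ($0\le i<j\le 3$), where all $Q_{ij}$ and all four $B$-quadreas are nonzero. Then $$\frac{E_{01}E_{23}}{Q_{01}Q_{23}}=\frac{E_{02}E_{13}}{Q_{02}Q_{13}}=\frac{E_{03}E_{12}}{Q_{03}Q_{12}}=\mathcal{R},\qquad\text{where}\quad \mathcal{R}\equiv\frac{16\mathcal{V}^2}{\mathcal{A}_{012}\mathcal{A}_{013}\mathcal{A}_{023}\mathcal{A}_{123}}.$$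
   Context: Let $\mathbb{F}$ be a field of characteristic not $2$, $\mathbb{V}^3=\mathbb{F}^3$ the space of row vectors, and $\mathbb{A}^3$ the three-dimensional affine space over $\mathbb{F}$ with associated vector space $\mathbb{V}^3$; $\overrightarrow{XY}=Y-X$ for points $X,Y$. Let $B$ be a symmetric invertible $3\times3$ matrix over $\mathbb{F}$. Define $v\cdot_B w=vBw^T$, $Q_B(v)=v\cdot_B v$, $v\times_B w=(v\times w)\,\mathrm{adj}\,B$ where $\times$ is the usual cross product and $\mathrm{adj}\,B=(\det B)B^{-1}$, and $[v_1,v_2,v_3]_B=v_1\cdot_B(v_2\times_B v_3)$. A tetrahedron $\overline{A_0A_1A_2A_3}$ is a collection of four points of $\mathbb{A}^3$. Its $B$-quadrances are $Q_{ij}=Q_B(\overrightarrow{A_iA_j})$ (symmetric in $i,j$). Its $B$-quadreas are $\mathcal{A}_{ijk}=A(Q_{ij},Q_{ik},Q_{jk})$ with $A(a,b,c)=(a+b+c)^2-2(a^2+b^2+c^2)$. Its $B$-quadrume is $\mathcal{V}=\frac{4}{\det B}[\overrightarrow{A_0A_1},\overrightarrow{A_0A_2},\overrightarrow{A_0A_3}]_B^2$. A $B$-normal vector of a plane is a nonzero vector $n$ with $\overrightarrow{XY}\cdot_B n=0$ for all points $X,Y$ of the plane. The $B$-dihedral spread between two planes with $B$-normal vectors $n_1,n_2$ (with $Q_B(n_1),Q_B(n_2)\neq0$) is $1-\frac{(n_1\cdot_B n_2)^2}{Q_B(n_1)Q_B(n_2)}$. For $\{i,j,k,l\}=\{0,1,2,3\}$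 with $i<j$, $E_{ij}$ denotes the $B$-dihedral spread between the planes $A_iA_jA_k$ and $A_iA_jA_l$ (planes through the indicated points). When the four $B$-quadreas are nonzero, each triple of points is non-collinear and each plane of the tetrahedron has non-null $B$-normal vectors, so all $E_{ij}$ are defined. *)

(* Defs.v *)
From mathcomp Require Import all_boot all_order all_algebra.

Set Implicit Arguments.
Unset Strict Implicit.
Unset Printing Implicit Defensive.

Import GRing.Theory.
Local Open Scope ring_scope.

(* The affine space A^3 is modelled by F^3 itself: points and vectors are both
   row vectors, and the vector from X to Y is Y - X. *)

Section BGeometry.

Variables (F : fieldType) (B : 'M[F]_3).
Implicit Types (u v w n X Y Z : 'rV[F]_3) (P : 'rV[F]_3 -> Prop).

Definition dotB v w : F := (v *m B *m w^T) 0 0.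

Definition quadB v : F := dotB v v.

(* Indices in 'I_3 are added modulo 3. *)
Definition cross v w : 'rV[F]_3 :=
  \row_(k < 3) (v 0 (k + 1) * w 0 (k + 2) - v 0 (k + 2) * w 0 (k + 1)).

Definition crossB v w : 'rV[F]_3 := cross v w *m \adj B.

Definition tripleB u v w : F := dotB u (crossB v w).

Definition plane_through X Y Z : 'rV[F]_3 -> Prop :=
  fun T => exists a b : F, T = X + a *: (Y - X) + b *: (Z - X).

Definition is_normalB P n : Prop :=
  n != 0 /\ forall X Y, P X -> P Y -> dotB (Y - X) n = 0.

(* The spread is a relation because it is expressed through a choice of normal
   vectors; for planes it does not depend on this choice, since the normal
   vectors of a plane are proportional. *)
Definition is_dihedral_spreadB P1 P2 (s : F) : Prop :=
  exists n1 n2,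
    [/\ is_normalB P1 n1, is_normalB P2 n2, quadB n1 != 0, quadB n2 != 0
      & s = 1 - dotB n1 n2 ^+ 2 / (quadB n1 * quadB n2)].

Section Tetrahedron.

Variable A : 'I_4 -> 'rV[F]_3.
Implicit Types i j k l : 'I_4.

Definition quadranceB i j : F := quadB (A j - A i).

Definition archimedes (a b c : F) : F :=
  (a + b + c) ^+ 2 - 2 * (a ^+ 2 + b ^+ 2 + c ^+ 2).

Definition quadreaB i j k : F :=
  archimedes (quadranceB i j) (quadranceB i k) (quadranceB j k).

Definition quadrumeB : F :=
  4 / \det B * tripleB (A 1 - A 0) (A 2 - A 0) (A 3 - A 0) ^+ 2.

Definition are_dihedral_spreadsB (E : 'I_4 -> 'I_4 -> F) : Prop :=
  forall i j k l, uniq [:: i; j; k; l] -> (i < j)%N ->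
    is_dihedral_spreadB (plane_through (A i) (A j) (A k))
                        (plane_through (A i) (A j) (A l)) (E i j).

End Tetrahedron.

End BGeometry.

(* Main.v *)
Require Import Defs.
From mathcomp Require Import all_boot all_order all_algebra.
From mathcomp Require Import ring.

Set Implicit Arguments.
Unset Strict Implicit.
Unset Printing Implicit Defensive.

Import GRing.Theory.
Local Open Scope ring_scope.

(** The whole statement follows from a closed form for a single dihedral
    spread: for every labelling i, j, k, l of the vertices,
      E_ij A_ijk A_ijl = 4 Q_ij V    ([dihedral_spreadE]).
    Multiplying the formulas for two opposite edges, each of the four quadreas
    occurs exactly once and Q_ij Q_kl factors out, so that each of the three
    quotients equals 16 V^2 / (A_012 A_013 A_023 A_123).

    The closed form is a computation in vector algebra. Put u, v, w for the
    edges from A_i to A_j, A_k, A_l, and n1 = u x_B v, n2 = u x_B w.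
    - A normal vector of a plane spanned by u and v is a multiple of u x_B v
      ([normalB_colinear]), and the spread is insensitive to the scaling of
      the normals, so it may be computed with n1 and n2.
    - The Binet-Cauchy identity for the form B ([dotB_crossB]) gives
      Q_B(u x_B v) = det B (Q(u) Q(v) - (u . v)^2), and the bracket is a quarter
      of the quadrea ([quadB_crossB_quadrea]).
    - The same identity applied to the normals themselves says that
      det B (Q(n1) Q(n2) - (n1 . n2)^2) = Q_B(n1 x_B n2), and n1 x_B n2 is
      parallel to the common edge u, with factor (det B)^2 [u, v, w],
      where [u, v, w] = u . (v x w) is the Euclidean triple product
      ([crossB_crossB]). This produces both Q_ij and the square of the volume
      in the numerator of the spread.
    Finally, the quadrume does not depend on the order of the four vertices,
    because [u, v, w] changes only by a sign. *)

(** * Coordinates in dimension three *)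

Section Coordinates.

Variable F : fieldType.
Implicit Types (u v w x y z : 'rV[F]_3) (M : 'M[F]_3).

Lemma sum3E (f : 'I_3 -> F) : \sum_(i < 3) f i = f 0 + f 1 + f 2.
Proof.
rewrite !big_ord_recl big_ord0 addr0 addrA.
by congr (f _ + f _ + f _); apply: val_inj.
Qed.

Lemma row3P x y : x 0 0 = y 0 0 -> x 0 1 = y 0 1 -> x 0 2 = y 0 2 -> x = y.
Proof.
move=> e0 e1 e2; apply/rowP => -[[|[|[|//]]] lt_k].
- by rewrite (_ : Ordinal lt_k = 0) //; apply: val_inj.
- by rewrite (_ : Ordinal lt_k = 1) //; apply: val_inj.
- by rewrite (_ : Ordinal lt_k = 2) //; apply: val_inj.
Qed.

Lemma crossE v w :
  [/\ cross v w 0 0 = v 0 1 * w 0 2 - v 0 2 * w 0 1,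
      cross v w 0 1 = v 0 2 * w 0 0 - v 0 0 * w 0 2
    & cross v w 0 2 = v 0 0 * w 0 1 - v 0 1 * w 0 0].
Proof.
by split; rewrite mxE; congr (v 0 _ * w 0 _ - v 0 _ * w 0 _); apply: val_inj.
Qed.

Lemma cross0E v w : cross v w 0 0 = v 0 1 * w 0 2 - v 0 2 * w 0 1.
Proof. by case: (crossE v w). Qed.
Lemma cross1E v w : cross v w 0 1 = v 0 2 * w 0 0 - v 0 0 * w 0 2.
Proof. by case: (crossE v w). Qed.
Lemma cross2E v w : cross v w 0 2 = v 0 0 * w 0 1 - v 0 1 * w 0 0.
Proof. by case: (crossE v w). Qed.

Lemma det3E M : \det M =
    M 0 0 * (M 1 1 * M 2 2 - M 1 2 * M 2 1)
  - M 0 1 * (M 1 0 * M 2 2 - M 1 2 * M 2 0)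
  + M 0 2 * (M 1 0 * M 2 1 - M 1 1 * M 2 0).
Proof.
rewrite (expand_det_row M 0) sum3E /cofactor !(expand_det_row _ 0).
rewrite !big_ord_recl !big_ord0 /cofactor !det_mx11 !mxE /=.
have liftE (i : 'I_3) (j : 'I_2) : lift i j = (bump i j)%:R :> 'I_3.
  by apply: val_inj; case: i j => [[|[|[|//]]] ?] [[|[|//]] ?].
rewrite !liftE /= !(expr0, expr1, sqrrN, expr1n, mul1r, addr0, exprD).
ring.
Qed.

Definition dot x y : F := (x *m y^T) 0 0.

Lemma dotE x y : dot x y = x 0 0 * y 0 0 + x 0 1 * y 0 1 + x 0 2 * y 0 2.
Proof. by rewrite /dot mxE sum3E !mxE. Qed.

Lemma mulrow3E x M k :
  (x *m M) 0 k = x 0 0 * M 0 k + x 0 1 * M 1 k + x 0 2 * M 2 k.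
Proof. by rewrite mxE sum3E. Qed.

Lemma dot_mull x y M : dot (x *m M) y = dot x (y *m M^T).
Proof. by rewrite /dot trmx_mul trmxK mulmxA. Qed.

Lemma dotZl a x y : dot (a *: x) y = a * dot x y.
Proof. by rewrite /dot -scalemxAl mxE. Qed.

Lemma dotZr a x y : dot x (a *: y) = a * dot x y.
Proof. by rewrite /dot linearZ -scalemxAr mxE. Qed.

Lemma dotC x y : dot x y = dot y x.
Proof. by rewrite !dotE; ring. Qed.

(** * The Euclidean cross product *)

Lemma dot_cross_self u v : dot (cross u v) u = 0.
Proof. by rewrite dotE cross0E cross1E cross2E; ring. Qed.

Lemma cross_crossr x y z : cross x (cross y z) = dot x z *: y - dot x y *: z.
Proof.
by apply: row3P; rewrite !(cross0E, cross1E, cross2E, dotE) !mxE; ring.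
Qed.

Lemma cross_crossl x y z : cross (cross x y) z = dot x z *: y - dot y z *: x.
Proof.
by apply: row3P; rewrite !(cross0E, cross1E, cross2E, dotE) !mxE; ring.
Qed.

Lemma dot_cross_cross u v x y :
  dot (cross u v) (cross x y) = dot u x * dot v y - dot u y * dot v x.
Proof. by rewrite !(dotE, cross0E, cross1E, cross2E); ring. Qed.

(** Pairing the left-hand side with z gives the triple product of x M, y M and
    z M, that is, the determinant of a product of two matrices. *)
Lemma cross_mulmx M x y :
  cross (x *m M) (y *m M) *m M^T = \det M *: cross x y.
Proof.
have scaleE k : (\det M *: cross x y) 0 k = \det M * cross x y 0 k.
  by rewrite mxE.
apply: row3P; rewrite scaleE mulrow3E !(cross0E, cross1E, cross2E) !mulrow3E;
  rewrite det3E ![M^T _ _]mxE; ring.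
Qed.

(** Expanding cross e (cross N x) = 0 gives (e . N) x = (e . x) N, and e . N is
    nonzero when e is a suitable coordinate vector. *)
Lemma cross_eq0_colinear N x :
  N != 0 -> cross N x = 0 -> exists c, x = c *: N.
Proof.
move=> /rV0Pn[k Nk_neq0] Nx0; pose e : 'rV[F]_3 := delta_mx 0 k.
have eE y : dot e y = y 0 k by rewrite /dot -rowE !mxE.
have := cross_crossr e N x; rewrite Nx0 !eE.
have -> : cross e 0 = 0.
  by apply: row3P; rewrite ?(cross0E, cross1E, cross2E) !mxE; ring.
move/esym/eqP; rewrite subr_eq0 => /eqP eqNx.
exists (x 0 k / N 0 k); apply: (scalerI Nk_neq0).
by rewrite -eqNx scalerA mulrC divfK.
Qed.

End Coordinates.

(** * Vector algebra of a symmetric form *)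

Section SymmetricForm.

Variables (F : fieldType) (B : 'M[F]_3).
Hypotheses (B_sym : B^T = B) (B_unit : B \in unitmx).
Implicit Types (u v w x y n X Y Z W : 'rV[F]_3).

Lemma detB_neq0 : \det B != 0.
Proof. by rewrite -unitfE -unitmxE. Qed.

Lemma dotB_dot x y : dotB B x y = dot (x *m B) y.
Proof. by []. Qed.

Lemma dotBC x y : dotB B x y = dotB B y x.
Proof. by rewrite !dotB_dot dot_mull B_sym dotC. Qed.

Lemma dotBZl a x y : dotB B (a *: x) y = a * dotB B x y.
Proof. by rewrite !dotB_dot -scalemxAl dotZl. Qed.

Lemma dotBZr a x y : dotB B x (a *: y) = a * dotB B x y.
Proof. by rewrite !dotB_dot dotZr. Qed.

Lemma adjB_sym : (\adj B)^T = \adj B.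
Proof. by rewrite trmx_adj B_sym. Qed.

Lemma det_adjB : \det (\adj B) = \det B ^+ 2.
Proof.
apply: (mulfI detB_neq0); rewrite -det_mulmx mul_mx_adj det_scalar; ring.
Qed.

Lemma cross_mulB x y : cross (x *m B) (y *m B) = crossB B x y.
Proof.
apply: (scalerI detB_neq0); rewrite /crossB [RHS]scalemxAl.
by rewrite -(cross_mulmx B x y) B_sym -(mulmxA _ B) mul_mx_adj mul_mx_scalar.
Qed.

Lemma crossB_mulB x y : crossB B x y *m B = \det B *: cross x y.
Proof. by rewrite /crossB -mulmxA mul_adj_mx mul_mx_scalar. Qed.

(** Binet-Cauchy for B: one of the two adjugates in the cross products cancels
    against B, the other one moves B inside the Euclidean cross product. *)
Lemma dotB_crossB u v x y :
  dotB B (crossB B u v) (crossB B x y)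
    = \det B * (dotB B u x * dotB B v y - dotB B u y * dotB B v x).
Proof.
rewrite dotB_dot crossB_mulB dotZl -cross_mulB dot_cross_cross.
by rewrite -!(dotC (_ *m B)) -!dotB_dot ![dotB B _ u]dotBC ![dotB B _ v]dotBC.
Qed.

Lemma tripleBE u v w : tripleB B u v w = \det B * dot u (cross v w).
Proof. by rewrite /tripleB dotBC dotB_dot crossB_mulB dotZl dotC. Qed.

(** The result is parallel to u because u is the common line of the two planes
    and hence orthogonal to both normals; the factor comes from [cross_mulmx]
    for the adjugate, of determinant (det B)^2. *)
Lemma crossB_crossB u v w :
  crossB B (crossB B u v) (crossB B u w)
    = (\det B ^+ 2 * dot u (cross v w)) *: u.
Proof.
rewrite /crossB -[X in cross _ _ *m X = _]adjB_sym cross_mulmx det_adjB -scalerA.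
congr (_ *: _); rewrite cross_crossr dot_cross_self scale0r subr0.
by congr (_ *: _); rewrite !(dotE, cross0E, cross1E, cross2E); ring.
Qed.

(** Applying [dotB_crossB] to the normals turns the left-hand side into the
    quadrance of n1 x_B n2, divided by det B. *)
Lemma quadB_crossB_gram u v w (n1 := crossB B u v) (n2 := crossB B u w) :
  quadB B n1 * quadB B n2 - dotB B n1 n2 ^+ 2
    = \det B ^+ 3 * dot u (cross v w) ^+ 2 * quadB B u.
Proof.
apply: (mulfI detB_neq0).
have := dotB_crossB n1 n2 n1 n2; rewrite [dotB B n2 n1]dotBC -expr2 => <-.
rewrite crossB_crossB dotBZl dotBZr /quadB; ring.
Qed.

Lemma quadB_sub x y :
  quadB B (x - y) = quadB B x + quadB B y - 2 * dotB B x y.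
Proof.
have eqB : dotB B (x - y) (x - y)
    = dotB B x x - dotB B x y - dotB B y x + dotB B y y.
  by rewrite /dotB !(mulmxBl, linearB, mulmxBr) /= !mxE; ring.
by rewrite /quadB eqB [dotB B y x]dotBC; ring.
Qed.

Lemma quadB_crossB_quadrea u v :
  4 * quadB B (crossB B u v)
    = \det B * archimedes (quadB B u) (quadB B v) (quadB B (v - u)).
Proof.
rewrite quadB_sub {1}/quadB dotB_crossB /archimedes [dotB B v u]dotBC /quadB.
by ring.
Qed.

(** If n is orthogonal to u and v, then n B is Euclidean-orthogonal to both,
    hence has zero cross product with u x v. *)
Lemma normalB_colinear X Y Z n :
  crossB B (Y - X) (Z - X) != 0 -> is_normalB B (plane_through X Y Z) n ->
  exists c, n = c *: crossB B (Y - X) (Z - X).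
Proof.
set u := Y - X; set v := Z - X => uv_neq0 [_ n_orth].
have PX : plane_through X Y Z X.
  by exists 0, 0; rewrite !scale0r !addr0.
have PY : plane_through X Y Z Y.
  by exists 1, 0; rewrite scale0r scale1r addr0 addrC subrK.
have PZ : plane_through X Y Z Z.
  by exists 0, 1; rewrite scale0r scale1r addr0 addrC subrK.
have un0 := n_orth _ _ PX PY; have vn0 := n_orth _ _ PX PZ.
have N_neq0 : cross u v != 0.
  by apply: contra_neq uv_neq0 => uv0; rewrite /crossB uv0 mul0mx.
have [|c nBE] := cross_eq0_colinear (x := n *m B) N_neq0.
  rewrite cross_crossl ![dot _ (n *m B)]dotC -!dotB_dot dotBC un0 dotBC vn0.
  by rewrite !scale0r subrr.
exists (c / \det B); rewrite -[n in LHS](mulmxK B_unit) nBE /invmx B_unit.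
by rewrite -scalemxAl -scalemxAr scalerA.
Qed.

(** The products S1 S2 and Q(n1) Q(n2) differ by the factor (det B / 4)^2; to
    avoid dividing by 4, both sides are compared after scaling by (det B)^2. *)
Lemma spreadE X Y Z W s :
  let u := Y - X in let v := Z - X in let w := W - X in
  let S1 := archimedes (quadB B u) (quadB B v) (quadB B (v - u)) in
  let S2 := archimedes (quadB B u) (quadB B w) (quadB B (w - u)) in
  S1 != 0 -> S2 != 0 ->
  is_dihedral_spreadB B (plane_through X Y Z) (plane_through X Y W) s ->
  s * (S1 * S2) = 4 * quadB B u * (4 / \det B * tripleB B u v w ^+ 2).
Proof.
move=> u v w S1 S2 S1_neq0 S2_neq0 [n1 [n2 [n1P n2P Qn1 Qn2 ->]]].
have crossB_neq0 x y :
    archimedes (quadB B x) (quadB B y) (quadB B (y - x)) != 0 ->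
    crossB B x y != 0.
  apply: contra_neq => xy0; apply: (mulfI detB_neq0).
  rewrite -quadB_crossB_quadrea xy0 /quadB dotB_dot mul0mx.
  by rewrite /dot mul0mx mxE !mulr0.
have [c n1E] := normalB_colinear (crossB_neq0 _ _ S1_neq0) n1P.
have [d n2E] := normalB_colinear (crossB_neq0 _ _ S2_neq0) n2P.
have := quadB_crossB_gram u v w.
have := quadB_crossB_quadrea u v; have := quadB_crossB_quadrea u w.
rewrite -/S1 -/S2 tripleBE.
move: Qn1 Qn2; rewrite n1E n2E /quadB !(dotBZl, dotBZr) -/u -/v -/w.
move: (dotB B (crossB B u v) (crossB B u v)) => q1.
move: (dotB B (crossB B u w) (crossB B u w)) => q2.
move: (dotB B (crossB B u v) (crossB B u w)) => p.
rewrite !mulf_eq0 !negb_or => /and3P[c0 _ q10] /and3P[d0 _ q20] e2 e1 gram.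
have D0 := detB_neq0.
have -> : 1 - (c * (d * p)) ^+ 2 / (c * (c * q1) * (d * (d * q2)))
    = (q1 * q2 - p ^+ 2) / (q1 * q2) by field; rewrite ?c0 ?d0 ?q10 ?q20.
rewrite gram; apply: (mulfI D0); apply: (mulfI D0).
have -> : forall t : F, \det B * (\det B * (t * (S1 * S2)))
   = t * ((\det B * S1) * (\det B * S2)) by move=> t; ring.
by rewrite -e1 -e2; field; rewrite ?D0 ?q10 ?q20.
Qed.

(** * The six spreads of a tetrahedron *)

Variable A : 'I_4 -> 'rV[F]_3.
Implicit Types i j k l : 'I_4.

Let Q := quadranceB B A.
Let S := quadreaB B A.

(** The quadrume computed from the edges at an arbitrary vertex i, in an
    arbitrary order, so that the formula for one edge applies to all six. *)
Definition quadrume_from i j k l : F :=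
  4 / \det B * tripleB B (A j - A i) (A k - A i) (A l - A i) ^+ 2.

Let V := quadrume_from.

Lemma quadranceBC i j : Q i j = Q j i.
Proof. by rewrite /Q /quadranceB -opprB -scaleN1r /quadB dotBZl dotBZr; ring. Qed.

Lemma quadreaB_swap12 i j k : S i j k = S j i k.
Proof. by rewrite /S /quadreaB -/Q [Q i j]quadranceBC /archimedes; ring. Qed.

Lemma quadreaB_swap23 i j k : S i j k = S i k j.
Proof. by rewrite /S /quadreaB -/Q [Q j k]quadranceBC /archimedes; ring. Qed.

Lemma quadrume_swap23 i j k l : V i j k l = V i k j l.
Proof.
rewrite /V /quadrume_from; congr (_ * _).
by rewrite !tripleBE !(dotE, cross0E, cross1E, cross2E) !mxE; ring.
Qed.

Lemma quadrume_swap34 i j k l : V i j k l = V i j l k.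
Proof.
rewrite /V /quadrume_from; congr (_ * _).
by rewrite !tripleBE !(dotE, cross0E, cross1E, cross2E) !mxE; ring.
Qed.

Lemma quadrume_swap12 i j k l : V i j k l = V j i k l.
Proof.
rewrite /V /quadrume_from; congr (_ * _).
by rewrite !tripleBE !(dotE, cross0E, cross1E, cross2E) !mxE; ring.
Qed.

Lemma dihedral_spreadE i j k l s :
  S i j k != 0 -> S i j l != 0 ->
  is_dihedral_spreadB B (plane_through (A i) (A j) (A k))
                        (plane_through (A i) (A j) (A l)) s ->
  s = 4 * Q i j * V i j k l / (S i j k * S i j l).
Proof.
move=> Sk Sl /spreadE sE.
have subA a b c : A c - A b = (A c - A a) - (A b - A a).
  by rewrite opprB addrA subrK.
move: Sk Sl; rewrite /S /quadreaB /quadranceB (subA i j k) (subA i j l) => Sk Sl.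
by rewrite /V /quadrume_from -sE // mulfK // mulf_neq0.
Qed.

Variable E : 'I_4 -> 'I_4 -> F.
Hypothesis E_spreads : are_dihedral_spreadsB B A E.
Hypothesis Q_neq0 : forall i j, (i < j)%N -> Q i j != 0.

(** The two faces at the edge ij and the two faces at the opposite edge kl are
    the four faces of the tetrahedron, so all the quadreas appear once. *)
Lemma opposite_dihedral_spreads i j k l :
  uniq [:: i; j; k; l] -> (i < j)%N -> (k < l)%N ->
  S i j k != 0 -> S i j l != 0 -> S i k l != 0 -> S j k l != 0 ->
  E i j * E k l / (Q i j * Q k l)
    = 16 * V i j k l ^+ 2 / (S i j k * S i j l * S i k l * S j k l).
Proof.
move=> ijkl ltij ltkl Sijk Sijl Sikl Sjkl.
have klij : uniq [:: k; l; i; j] by rewrite -(rot_uniq 2).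
have Skli : S k l i = S i k l by rewrite quadreaB_swap23 quadreaB_swap12.
have Sklj : S k l j = S j k l by rewrite quadreaB_swap23 quadreaB_swap12.
have Vklij : V k l i j = V i j k l.
  rewrite quadrume_swap23 quadrume_swap12 quadrume_swap34.
  by rewrite quadrume_swap23.
rewrite (dihedral_spreadE Sijk Sijl (E_spreads ijkl ltij)).
have -> : E k l = 4 * Q k l * V i j k l / (S i k l * S j k l).
  rewrite -Skli -Sklj -Vklij.
  by apply: dihedral_spreadE (E_spreads klij ltkl); rewrite ?Skli ?Sklj.
by field; rewrite Sijk Sijl Sikl Sjkl !Q_neq0.
Qed.

End SymmetricForm.

Theorem theorem17 (F : fieldType) (char_neq2 : 2%N \notin [pchar F])
  (B : 'M[F]_3) (B_sym : B^T = B) (B_unit : B \in unitmx)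
  (A : 'I_4 -> 'rV[F]_3)
  (E : 'I_4 -> 'I_4 -> F) (E_spreads : are_dihedral_spreadsB B A E) :
  let Q := quadranceB B A in
  let S := quadreaB B A in
  let V := quadrumeB B A in
  let R := 16 * V ^+ 2 / (S 0 1 2 * S 0 1 3 * S 0 2 3 * S 1 2 3) in
  (forall i j : 'I_4, (i < j)%N -> Q i j != 0) ->
  [/\ S 0 1 2 != 0, S 0 1 3 != 0, S 0 2 3 != 0 & S 1 2 3 != 0] ->
  [/\ E 0 1 * E 2 3 / (Q 0 1 * Q 2 3) = E 0 2 * E 1 3 / (Q 0 2 * Q 1 3),
      E 0 2 * E 1 3 / (Q 0 2 * Q 1 3) = E 0 3 * E 1 2 / (Q 0 3 * Q 1 2)
    & E 0 3 * E 1 2 / (Q 0 3 * Q 1 2) = R].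
Proof.
move=> Q S V R Q_neq0 [S012 S013 S023 S123].
have Sswap12 := quadreaB_swap12 B A; have Sswap23 := quadreaB_swap23 B A.
have opposite i j k l := @opposite_dihedral_spreads
  F B B_sym B_unit A E E_spreads Q_neq0 i j k l.
have S021 : S 0 2 1 = S 0 1 2 by apply: Sswap23.
have S213 : S 2 1 3 = S 1 2 3 by apply: Sswap12.
have S031 : S 0 3 1 = S 0 1 3 by apply: Sswap23.
have S032 : S 0 3 2 = S 0 2 3 by apply: Sswap23.
have S312 : S 3 1 2 = S 1 2 3 by rewrite /S Sswap12 Sswap23.
have -> : E 0 1 * E 2 3 / (Q 0 1 * Q 2 3) = R by rewrite opposite.
have -> : E 0 2 * E 1 3 / (Q 0 2 * Q 1 3) = R.
  rewrite opposite -?/S ?S021 ?S213 // (quadrume_swap23 B_sym A).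
  by rewrite /R; congr (_ / _); ring.
have -> : E 0 3 * E 1 2 / (Q 0 3 * Q 1 2) = R.
  rewrite opposite -?/S ?S031 ?S032 ?S312 //.
  rewrite (quadrume_swap23 B_sym A) (quadrume_swap34 B_sym A).
  by rewrite /R; congr (_ / _); ring.
by [].
Qed.
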